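(* Let $M$ be a manifold and let $d:M\times M\to\mathbb{R}$ be a distance on $M$ whose topology agrees with that of $M$. Let $(\gamma_i:[0,a_i)\to M)_{i\in\mathbb{N}}$, $a_i\in\mathbb{R}^+\cup\{\infty\}$, be a sequence of $C^0$ curves in $M$. If there exists $x\in M$ so that $\gamma_i(0)\to x$, and if for all $i\in\mathbb{N}$ and all $t_1,t_2\in[0,a_i)$, $$d(\gamma_i(t_1),\gamma_i(t_2))\le |t_1-t_2|,$$ then there exist a $C^0$ curve $\gamma:[0,a)\to M$, $a\in(0,\limsup_i a_i]$, with $\gamma(0)=x$, and a subsequence $(\gamma_{i_k})_k$ of $(\gamma_i)_i$ so that 1. $a\le\limsup_k a_{i_k}$, and 2. for all compact $C\subset[0,a)$ there exists $J\in\mathbb{N}$ so that $k\ge J$ implies that $C\subset[0,a_{i_k})$, and $(\gamma_{i_k}|_C)_{k\ge J}$ converges uniformly to $\gamma|_C$ with respect to $d$. That is, $(\gamma_{i_k})_k$ $d$-converges uniformly on compacta to $\gamma$.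
   Context: Manifolds are smooth, Hausdorff, paracompact and separable. A distance means a metric in the sense of metric spaces; it is not assumed to be complete. $\limsup_i a_i$ may be $\infty$. Curves $\beta_k:[0,c_k)\to M$ with $\beta_k(0)\to x$ are said to $d$-converge uniformly on compacta to a continuous curve $\gamma:[0,a)\to M$ if $\gamma(0)=x$ and for all $\delta<a$ there exists $N_\delta\in\mathbb{N}$ so that $k\ge N_\delta$ implies $c_k>\delta$, and $(\beta_k|_{[0,\delta]})_{k\ge N_\delta}$ converges uniformly to $\gamma|_{[0,\delta]}$ with respect to $d$.
   Formalization: The formal theorem additionally assumes limsup a_i > 0; without this the claim fails (e.g. a_i = 1/(i+1) with constant curves at x), because the interval (0, limsup a_i] is then empty. *)

(* Defs.v *)
From HB Require Import structures.
From mathcomp Require Import all_boot all_order all_algebra.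
From mathcomp Require Import all_classical all_reals all_analysis.

Set Implicit Arguments.
Unset Strict Implicit.
Unset Printing Implicit Defensive.

Import Order.TTheory GRing.Theory Num.Theory.
Import numFieldNormedType.Exports.

Local Open Scope classical_set_scope.
Local Open Scope ring_scope.

Definition separable_space (T : topologicalType) : Prop :=
  exists2 D : set T, countable D & dense D.

Definition open_cover (T : topologicalType) (C : set (set T)) : Prop :=
  (forall U, C U -> open U) /\ \bigcup_(U in C) U = [set: T].

Definition locally_finite (T : topologicalType) (C : set (set T)) : Prop :=
  forall x : T, exists2 N, nbhs x N &
    finite_set [set U | C U /\ U `&` N !=set0].

Definition paracompact (T : topologicalType) : Prop :=
  forall C : set (set T), open_cover C ->
    exists D : set (set T), [/\ open_cover D, locally_finite D &
      forall V, D V -> exists2 U, C U & V `<=` U].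

(* Meant for open U: whether f is C^k on U then depends only on the values of
   f on U, so that a partial map can be represented by any total extension. *)
Fixpoint Ck_on (R : realType) (V W : normedModType R) (k : nat)
    (U : set V) (f : V -> W) : Prop :=
  match k with
  | 0%N => {within U, continuous f}
  | k'.+1 => (forall x, U x -> differentiable f x) /\
             (forall v, Ck_on k' U (fun x => 'D_v f x))
  end.

Definition smooth_on (R : realType) (V W : normedModType R)
    (U : set V) (f : V -> W) : Prop :=
  forall k, Ck_on k U f.

(* A homeomorphism from an open subset of T onto an open subset of R^n; the
   values of the two maps outside those subsets are irrelevant. *)
Record chart (R : realType) (n : nat) (T : topologicalType) := Chart {
  chart_dom : set T ;
  chart_map : T -> 'rV[R]_n ;
  chart_inv : 'rV[R]_n -> T ;
  chart_dom_open : open chart_dom ;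
  chart_codom_open : open (chart_map @` chart_dom) ;
  chart_mapK : forall p, chart_dom p -> chart_inv (chart_map p) = p ;
  chart_map_continuous : {within chart_dom, continuous chart_map} ;
  chart_inv_continuous :
    {within chart_map @` chart_dom, continuous chart_inv}
}.

Definition smooth_atlas (R : realType) (n : nat) (T : topologicalType)
    (A : set (chart R n T)) : Prop :=
  (forall p : T, exists2 c, A c & chart_dom c p) /\
  (forall c c', A c -> A c' ->
    smooth_on (chart_map c @` (chart_dom c `&` chart_dom c'))
              (chart_map c' \o chart_inv c)).

(* The atlas is not required to be maximal: any smooth atlas determines the
   smooth structure. *)
Record smooth_manifold (R : realType) (n : nat) := SmoothManifold {
  manifold_space :> topologicalType ;
  manifold_hausdorff : hausdorff_space manifold_space ;
  manifold_paracompact : paracompact manifold_space ;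
  manifold_separable : separable_space manifold_space ;
  manifold_atlas : set (chart R n manifold_space) ;
  manifold_atlasP : smooth_atlas manifold_atlas
}.

Definition is_distance (R : realType) (T : Type) (d : T -> T -> R) : Prop :=
  [/\ forall x y, 0 <= d x y,
      forall x y, d x y = 0 <-> x = y,
      forall x y, d x y = d y x &
      forall x y z, d x z <= d x y + d y z].

Definition induces_topology (R : realType) (T : topologicalType)
    (d : T -> T -> R) : Prop :=
  forall (x : T) (A : set T),
    nbhs x A <-> exists2 e : R, 0 < e & [set y | d x y < e] `<=` A.

(* The interval [0, a), where a may be infinite. A curve [0, a) -> T is
   represented by a total function R -> T whose values off [0, a) are
   irrelevant. *)
Definition ray (R : realType) (a : \bar R) : set R :=
  [set t | 0 <= t /\ (t%:E < a)%E].

Definition converges_uniformly (R : realType) (T S : Type) (d : T -> T -> R)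
    (A : set S) (f : nat -> S -> T) (g : S -> T) : Prop :=
  forall e : R, 0 < e ->
    exists K : nat, forall k, (K <= k)%N -> forall t, A t -> d (f k t) (g t) < e.

Definition converges_uniformly_on_compacta (R : realType)
    (T : topologicalType) (d : T -> T -> R)
    (c : nat -> \bar R) (beta : nat -> R -> T)
    (a : \bar R) (gamma : R -> T) (x : T) : Prop :=
  [/\ (fun k => beta k 0) @ \oo --> x,
      {within ray a, continuous gamma},
      gamma 0 = x &
      forall delta : R, (delta%:E < a)%E ->
        (exists N : nat, forall k, (N <= k)%N -> (delta%:E < c k)%E) /\
        converges_uniformly d `[0, delta] beta gamma].

(* Main.v *)
Require Import Defs.
From HB Require Import structures.
From mathcomp Require Import all_boot all_order all_algebra.
From mathcomp Require Import all_classical all_reals all_analysis.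
From mathcomp Require Import lra.

Import Order.TTheory GRing.Theory Num.Theory.
Import numFieldNormedType.Exports.

Local Open Scope classical_set_scope.
Local Open Scope ring_scope.

(* Only some a > 0 is asked for, not a maximal one. Take a smaller than
   limsup a_i and than half the radius of a d-ball inside a compact
   neighbourhood of x: infinitely many curves are then defined on [0, a] and,
   being 1-Lipschitz, stay in that neighbourhood. The limit along an ultrafilter
   of such indices exists pointwise, is 1-Lipschitz, and by compactness of [0, a]
   is uniform, so a subsequence converging uniformly on [0, a] can be picked. *)

(** A small closed ball in the chart image is compact by Heine-Borel. Its image under [chart_inv]
    stays compact, and is a neighbourhood of [x] because [chart_map] is continuous on an open
    domain. *)
Lemma manifold_compact_nbhs (R : realType) (n : nat) (M : smooth_manifold R n)
    (x : M) : exists2 K : set M, nbhs x K & compact K.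
Proof.
have [/(_ x) [c _ cx] _] := manifold_atlasP M.
have : nbhs (chart_map c x) (chart_map c @` chart_dom c).
  by apply: open_nbhs_nbhs; split; [exact: chart_codom_open | exists x].
move=> /nbhs_closedballP[r rsub].
exists (chart_inv c @` closed_ball (chart_map c x) r%:num).
  have cball : nbhs (chart_map c x) (closed_ball (chart_map c x) r%:num).
    by apply: filterS (@subset_closed_ball _ _ _ _) _; exact: nbhsx_ballx.
  have /subspace_continuousP/(_ x cx)/(_ _ cball) := @chart_map_continuous _ _ _ c.
  have dom_x : nbhs x (chart_dom c).
    by apply: open_nbhs_nbhs; split=> //; exact: chart_dom_open.
  rewrite /= /within /= nbhs_simpl /= => near_ball.
  apply: filterS2 dom_x near_ball => y cy /(_ cy) By.
  by exists (chart_map c y) => //; rewrite chart_mapK.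
apply: continuous_compact.
  exact: continuous_subspaceW rsub (@chart_inv_continuous _ _ _ c).
apply: bounded_closed_compact; last exact: closed_ball_closed.
exists (`|chart_map c x| + r%:num); split; first exact: num_real.
move=> m m_gt y; rewrite closed_ballE // => y_near.
apply: le_trans (ltW m_gt); rewrite -lerBlDl.
by apply: le_trans (lerB_dist _ _) _; rewrite distrC.
Qed.

(** For an ultrafilter a cluster point is a limit: if the preimage of [B] were not in [U], that of
    its complement would be, and the complement would have to meet [B]. *)
Lemma ultra_cvg_compact (I : Type) (T : topologicalType) (U : set_system I)
    (K : set T) (f : I -> T) :
  UltraFilter U -> compact K -> U (f @^-1` K) ->
  exists y : T, forall B, nbhs y B -> U (f @^-1` B).
Proof.
move=> U_ultra K_compact UK.
have [y [_ y_cluster]] := K_compact (fmap f U) _ UK.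
exists y => B By; have [//|U_notB] := in_ultra_setVsetC (f @^-1` B) U_ultra.
have [z [notBz Bz]] := y_cluster (~` B) B U_notB By.
by case: (notBz Bz).
Qed.

(** The limsup is an infimum of suprema over sets of the filter, and the tail from [N] on is one of
    these sets. *)
Lemma limn_esup_gt_infinitely_often (R : realType) (u : nat -> \bar R)
    (l : \bar R) (N : nat) :
  (l < limn_esup u)%E -> exists2 i, (N <= i)%N & (l < u i)%E.
Proof.
move=> l_lt.
have /ereal_sup_gt[_ [i /= Ni <-] lui] :
    (l < ereal_sup (u @` [set i | (N <= i)%N]))%E.
  apply: lt_le_trans l_lt _; apply: ereal_inf_lbound.
  by exists [set i | (N <= i)%N] => //; exists N.
by exists i.
Qed.

Lemma limn_esup_ge (R : realType) (u : nat -> \bar R) (l : \bar R) :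
  (forall i, (l <= u i)%E) -> (l <= limn_esup u)%E.
Proof.
move=> lu; apply: le_ereal_inf_tmp => _ [A [N _ NA] <-].
by apply: le_trans (lu N) _; apply: ereal_sup_ubound; exists N => //; apply: NA => /=.
Qed.

Section LipschitzLimit.
Variables (R : realType) (T : Type) (d : T -> T -> R).
Hypothesis d_distance : is_distance d.
Variables (I : Type) (F : set_system I) (C : set R).
Variables (f : I -> R -> T) (g : R -> T).
Hypothesis f_lipschitz : \forall i \near F, forall s t, C s -> C t ->
  d (f i s) (f i t) <= `|s - t|.
Hypothesis f_cvg : forall t, C t -> forall e, 0 < e ->
  \forall i \near F, d (f i t) (g t) < e.

(** Compare [g] with a single [f i] that is within [e / 2] of it at both [s] and [t]; then let [e]
    tend to 0. *)
Lemma pointwise_limit_lipschitz : ProperFilter F ->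
  forall s t, C s -> C t -> d (g s) (g t) <= `|s - t|.
Proof.
have [_ _ dC dD] := d_distance.
move=> F_proper s t Cs Ct; apply/ler_addgt0Pr => e e_gt0.
have e2 : 0 < e / 2 by lra.
have [i [[lip fs] ft]] := filter_ex
  (filterI (filterI f_lipschitz (f_cvg s Cs (e / 2) e2))
           (f_cvg t Ct (e / 2) e2)).
have := dD (g s) (f i s) (g t); have := dD (f i s) (f i t) (g t).
have := lip s t Cs Ct; rewrite (dC (g s) (f i s)); move: fs ft => /=; lra.
Qed.

Lemma pointwise_limit_uniform : ProperFilter F -> compact C ->
  forall e, 0 < e ->
  \forall i \near F, forall t, C t -> d (f i t) (g t) < e.
Proof.
have [_ _ dC dD] := d_distance.
move=> F_proper C_compact e e_gt0.
have g_lipschitz := pointwise_limit_lipschitz F_proper.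
(* Compactness as near covering: a bound that holds jointly for [s] near each [t] in [C] and [i]
   near [F] holds on all of [C] for [i] near [F]. The joint bound comes from three errors below
   [e / 3]: two Lipschitz moves between [s] and [t], and the convergence at [t]. *)
have /compact_near_coveringP/near_covering_withinP C_cover := C_compact.
have e3 : 0 < e / 3 by lra.
apply: (C_cover _ F (fun i t => d (f i t) (g t) < e)) => t Ct.
have t_ball : nbhs t [set s | `|t - s| < e / 3] by exact: nbhsx_ballx.
near=> s i => Cs.
have ts : `|t - s| < e / 3 by near: s.
have ft : d (f i t) (g t) < e / 3 by near: i; exact: f_cvg.
have lip : d (f i s) (f i t) <= `|s - t|.
  suff : forall s t, C s -> C t -> d (f i s) (f i t) <= `|s - t| by exact.
  by near: i.
have := dD (f i s) (f i t) (g s); have := dD (f i t) (g t) (g s).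
have := g_lipschitz t s Ct Cs; rewrite distrC in lip; lra.
Unshelve. all: by end_near. Qed.

End LipschitzLimit.

(** Recursive choice: the lower bound passed to [h] at each stage is the successor of the previous
    index, which forces strict growth. *)
Lemma extract_subsequence (P : nat -> nat -> Prop) :
  (forall k N, exists2 i, (N <= i)%N & P k i) ->
  exists2 phi : nat -> nat, {homo phi : k l / (k < l)%N} & forall k, P k (phi k).
Proof.
move=> exP.
have /choice[h hP] (kN : nat * nat) : exists i, (kN.2 <= i)%N /\ P kN.1 i.
  by have [i] := exP kN.1 kN.2; exists i.
pose phi := fix phi k := if k is k'.+1 then h (k, (phi k').+1) else h (0, 0)%N.
exists phi; last by case=> [|k]; exact: (hP (_, _)).2.
by apply: homo_ltn => [|k]; [exact: ltn_trans | exact: (hP (_, _)).1].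
Qed.

Theorem theorem3p3 (R : realType) (n : nat) (M : smooth_manifold R n)
    (d : M -> M -> R)
    (d_distance : is_distance d)
    (d_topology : induces_topology d)
    (a_ : nat -> \bar R)
    (a_gt0 : forall i, (0 < a_ i)%E)
    (limsup_gt0 : (0 < limn_esup a_)%E)
    (gamma_ : nat -> R -> M)
    (gamma_continuous : forall i, {within ray (a_ i), continuous (gamma_ i)})
    (x : M)
    (gamma_start : (fun i => gamma_ i 0) @ \oo --> x)
    (gamma_lipschitz : forall i t1 t2, ray (a_ i) t1 -> ray (a_ i) t2 ->
      d (gamma_ i t1) (gamma_ i t2) <= `|t1 - t2|) :
  exists (a : \bar R) (gamma : R -> M) (phi : nat -> nat),
    [/\ (0 < a)%E /\ (a <= limn_esup a_)%E,
        {within ray a, continuous gamma} /\ gamma 0 = x,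
        {homo phi : k l / (k < l)%N} &
        [/\ (a <= limn_esup (a_ \o phi))%E,
            forall C : set R, compact C -> C `<=` ray a ->
              exists J : nat,
                (forall k, (J <= k)%N -> C `<=` ray (a_ (phi k))) /\
                converges_uniformly d C
                  (fun k => gamma_ (phi (J + k)%N)) gamma &
            converges_uniformly_on_compacta d (a_ \o phi)
              (fun k => gamma_ (phi k)) a gamma x]].
Proof.
have [_ d_eq dC dD] := d_distance.
have nbhs_dball y e : 0 < e -> nbhs y [set z | d y z < e].
  by move=> e_gt0; apply/d_topology; exists e.
have [K /d_topology[e e_gt0 dball_K] K_compact] := manifold_compact_nbhs R n M x.
(* Being below the limsup leaves infinitely many curves defined on [0, r]. A curve starting within
   [e / 2] of [x] stays in the [e]-ball up to time [r], since [r < e / 2]. *)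
have [r [r_gt0 r_lt r_e]] :
    exists r, [/\ 0 < r, (r%:E < limn_esup a_)%E & r < e / 2].
  case: (limn_esup a_) limsup_gt0 => [l| |//].
    rewrite lte_fin => l_gt0; exists (Num.min (l / 2) (e / 3)).
    by rewrite lte_fin lt_min gt_min gt_min; split; [lra | apply/orP; left; lra
                                                         | apply/orP; right; lra].
  by move=> _; exists (e / 3); rewrite ltry; split=> //; lra.
have ray_sub i t : (r%:E < a_ i)%E -> `[0, r]%classic t -> ray (a_ i) t.
  rewrite /= in_itv /= => r_lt_a /andP[t_ge0 t_le]; split=> //.
  by apply: le_lt_trans r_lt_a; rewrite lee_fin.
have F_proper : ProperFilter (within [set i | (r%:E < a_ i)%E] \oo).
  apply: Build_ProperFilter => -[N _ NF].
  have [i Ni ri] := limn_esup_gt_infinitely_often R a_ _ N r_lt.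
  exact: NF Ni ri.
have [U [U_ultra FU]] := ultraFilterLemma F_proper.
have U_dom : U [set i | (r%:E < a_ i)%E] by apply: FU; exact: withinT.
have U_oo A : (\oo)%classic A -> U A.
  by move=> ooA; apply: FU; apply: filterS ooA.
have U_lipschitz : \forall i \near U, forall s t, `[0, r]%classic s -> `[0, r]%classic t ->
    d (gamma_ i s) (gamma_ i t) <= `|s - t|.
  apply: filterS U_dom => i ri s t s_in t_in.
  by apply: gamma_lipschitz; exact: ray_sub.
have zero_in : `[0, r]%classic 0 by rewrite /= in_itv /= lexx ltW.
(* Pointwise limits along [U]; off [0, r] the value [x] is an arbitrary default. *)
have /choice[gamma gamma_cvg] t : exists y, `[0, r]%classic t ->
    forall e', 0 < e' -> \forall i \near U, d (gamma_ i t) y < e'.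
  have [t_in|t_out] := pselect (`[0, r]%classic t); last by exists x.
  have UK : U ((fun i => gamma_ i t) @^-1` K).
    have e2 : 0 < e / 2 by lra.
    have near_x := U_oo _ (gamma_start _ (nbhs_dball x _ e2)).
    apply: filterS3 U_dom U_lipschitz near_x => i ri lip /= x_near.
    apply: dball_K => /=; have := dD x (gamma_ i 0) (gamma_ i t).
    have := lip 0 t zero_in t_in; rewrite sub0r normrN ger0_norm; last first.
      by move: t_in; rewrite /= in_itv /= => /andP[].
    by have : t <= r; [move: t_in; rewrite /= in_itv /= => /andP[] | lra].
  have [y y_lim] := ultra_cvg_compact _ _ U K _ U_ultra K_compact UK.
  exists y => _ e' e'_gt0.
  apply: filterS (y_lim _ (nbhs_dball y e' e'_gt0)) => i /=.
  by rewrite dC.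
have gamma_lip := pointwise_limit_lipschitz _ _ d d_distance _ _ _ _ _
  U_lipschitz gamma_cvg _.
have gamma_unif := pointwise_limit_uniform _ _ d d_distance _ _ _ _ _
  U_lipschitz gamma_cvg _ (@segment_compact R 0 r).
(* Since [U] refines [\oo], the starting points tend along [U] to both [x] and [gamma 0]. *)
have gamma0 : gamma 0 = x.
  apply/d_eq/eqP; rewrite eq_le; apply/andP; split; last by have [] := d_distance.
  apply/ler_addgt0Pr => e' e'_gt0; have e'2 : 0 < e' / 2 by lra.
  have [i [/= i_x i_gamma]] := filter_ex (filterI
    (U_oo _ (gamma_start _ (nbhs_dball x _ e'2))) (gamma_cvg 0 zero_in _ e'2)).
  have := dD (gamma 0) (gamma_ i 0) x.
  rewrite (dC (gamma 0) (gamma_ i 0)) (dC (gamma_ i 0) x); lra.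
have [phi phi_mono phiP] : exists2 phi : nat -> nat,
    {homo phi : k l / (k < l)%N} &
    forall k, (r%:E < a_ (phi k))%E /\
      forall t, `[0, r]%classic t -> d (gamma_ (phi k) t) (gamma t) < k.+1%:R^-1.
  apply: (extract_subsequence (fun k i => (r%:E < a_ i)%E /\
      forall t, `[0, r]%classic t -> d (gamma_ i t) (gamma t) < k.+1%:R^-1)) => k N.
  have k_gt0 : 0 < k.+1%:R^-1 :> R by rewrite invr_gt0.
  (* Sets of [U] meet every tail, so the index can be taken beyond any [N]. *)
  have [i [[Ni ri] i_near]] := filter_ex (filterI
    (filterI (U_oo _ (nbhs_infty_ge N)) U_dom) (gamma_unif _ _ k_gt0)).
  by exists i.
have phi_ge k : (k <= phi k)%N.
  by elim: k => // k IH; apply: leq_ltn_trans IH _; exact: phi_mono.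
have phi_unif e' : 0 < e' -> exists N : nat, forall k, (N <= k)%N ->
    forall t, `[0, r]%classic t -> d (gamma_ (phi k) t) (gamma t) < e'.
  move=> e'_gt0; have [N _ Ne'] := near_infty_natSinv_lt (PosNum e'_gt0).
  exists N => k Nk t t_in; apply: lt_trans (Ne' k Nk).
  exact: (phiP k).2.
have ray_itv t : ray r%:E t -> `[0, r]%classic t.
  by move=> [t_ge0]; rewrite /= in_itv /= lte_fin t_ge0 => /ltW.
have gamma_cont : {within ray r%:E, continuous gamma}.
  apply/subspace_continuousP => t /ray_itv t_in A /d_topology[e' e'_gt0 sub_A].
  have t_ball : nbhs t [set s | `|t - s| < e'] by exact: nbhsx_ballx.
  rewrite nbhs_simpl /= /within /=.
  apply: filterS t_ball => s /= ts /ray_itv s_in; apply: sub_A => /=.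
  exact: le_lt_trans (gamma_lip _ _ _ t_in s_in) ts.
(* With [a = r], the ray [0, a) lies in [0, r], where all selected curves are defined and converge
   uniformly; hence [J = 0] serves every compact [C]. *)
exists r%:E, gamma, phi; split=> //; first by rewrite lte_fin; split=> //; exact: ltW.
split.
- by apply: limn_esup_ge => k; exact: ltW (phiP k).1.
- move=> C _ C_ray; exists 0%N; split.
    by move=> k _ t /C_ray/ray_itv; exact: ray_sub (phiP k).1.
  move=> e' /phi_unif[N Ne']; exists N => k Nk t /C_ray/ray_itv t_in.
  exact: Ne'.
- split=> //.
    (* Convergence of the starting points passes to the subsequence because [k <= phi k]. *)
    move=> A /gamma_start[N _ NA]; exists N => // k /= Nk.
    by apply: NA => /=; exact: leq_trans Nk (phi_ge k).
  move=> delta; rewrite lte_fin => delta_r; split.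
    exists 0%N => k _; apply: lt_trans (phiP k).1.
    by rewrite lte_fin.
  move=> e' /phi_unif[N Ne']; exists N => k Nk t.
  rewrite /= in_itv /= => /andP[t_ge0 t_delta]; apply: Ne' => //.
  by rewrite /= in_itv /= t_ge0; exact: le_trans t_delta (ltW delta_r).
Qed.
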